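(* For every $n \in \mathbb{N}$ and every $T \in \{0,1,\ldots,n\}$, there is a polynomial $P_T(x_1,\ldots,x_n)$ with integer coefficients of degree at most $3\sqrt{n}$ such that for all $a \in \{0,1\}^n$, $P_T(a) \equiv 0 \pmod 6$ if and only if $\sum_i a_i = T$. *)

(* Defs.v *)
From HB Require Import structures.
From mathcomp Require Import all_boot all_order all_algebra.
From mathcomp Require Import mpoly.

Set Implicit Arguments.
Unset Strict Implicit.
Unset Printing Implicit Defensive.

Import Order.TTheory GRing.Theory Num.Theory.
Local Open Scope ring_scope.

(* [msize p] is one more than the total degree of [p], except that
   [msize 0 = 0]; hence the predecessor.  The zero polynomial gets degree 0,
   which is as harmless as -oo for an upper bound by a nonnegative number. *)
Definition total_degree (n : nat) (K : nzRingType) (p : {mpoly K[n]}) : nat :=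
  (msize p).-1.

(* Main.v *)
Require Import Defs.
From HB Require Import structures.
From mathcomp Require Import all_boot all_order all_algebra.
From mathcomp Require Import mpoly.
From mathcomp Require Import zify ring.

(** For q a power of a prime p, the binomial 'C(m, q-1) is 1 mod p when q
    divides m + 1 and 0 otherwise.  Since 'C(w + c, q-1) is, by Vandermonde,
    an integer combination of the 'C(w, j), j < q, which are the values of the
    elementary symmetric polynomials at a 0/1 point of weight w, the condition
    w = T mod q is the vanishing mod p of a polynomial of degree at most q-1.
    Take q2 a power of 2 and q3 a power of 3, the least ones exceeding sqrt n,
    so that q2 - 1 and q3 - 1 are at most 3 sqrt n: by the Chinese remainder
    theorem q2 * q3 > n makes the two congruences equivalent to w = T, and the
    two polynomials combine into one mod 6. *)

Set Implicit Arguments.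
Unset Strict Implicit.
Unset Printing Implicit Defensive.

Import Order.TTheory GRing.Theory Num.Theory.
Local Open Scope ring_scope.

(** In [j * 'C(p ^ k, j) = p ^ k * 'C((p ^ k).-1, j.-1)], a binomial on the left prime to [p] would
    force [p ^ k] to divide [j], which is too small. *)
Lemma dvdn_bin_expn (p k j : nat) :
  prime p -> (0 < j < p ^ k)%N -> (p %| 'C(p ^ k, j))%N.
Proof.
move=> pr_p /andP[j_gt0 j_lt]; apply: contraLR j_lt => pNC; rewrite -leqNgt.
apply: dvdn_leq => //; rewrite -(@Gauss_dvdl _ j 'C(p ^ k, j)).
  by case: j j_gt0 pNC => // j _ _; rewrite -mul_bin_diag dvdn_mulr.
by rewrite coprimeXl // prime_coprime.
Qed.

(** In the Vandermonde expansion only the term of index 0 survives mod [p]. *)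
Lemma modn_bin_period (p k m j : nat) :
  prime p -> (j < p ^ k)%N -> 'C(p ^ k + m, j) = 'C(m, j) %[mod p].
Proof.
move=> pr_p j_lt; rewrite -binomial.Vandermonde big_ord_recl bin0 mul1n subn0.
rewrite -[in RHS](addn0 'C(m, j)); apply/eqP; rewrite eqn_modDl mod0n.
apply: dvdn_sum => i _; apply/dvdn_mulr/dvdn_bin_expn => //=.
by apply: leq_ltn_trans j_lt; case: i.
Qed.

Lemma modn_bin_pred_expn (p k m : nat) :
  prime p -> 'C(m, (p ^ k).-1) = (p ^ k %| m.+1)%N %[mod p].
Proof.
move=> pr_p; set q := (p ^ k)%N.
have q_gt0 : (0 < q)%N by rewrite expn_gt0 prime_gt0.
(* Lowering [m] by [q] changes neither side mod [p]; below [q] the binomial is nonzero only at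
   [m = q.-1]. *)
elim/ltn_ind: m => m IHm; have [m_lt | q_le] := ltnP m q; last first.
  rewrite -(subnKC q_le) modn_bin_period ?ltn_predL //.
  by rewrite -addnS dvdn_addr // IHm // ltn_subrL q_gt0 (leq_trans q_gt0).
have [m_eq | m_neq] := eqVneq m q.-1.
  by rewrite m_eq binn prednK // dvdnn.
have m_lt' : (m < q.-1)%N by lia.
by rewrite bin_small // gtnNdvd // -ltn_predRL.
Qed.

Definition shifted_bin_mpoly (n c k : nat) : {mpoly int[n]} :=
  \sum_(j < k.+1) 'C(c, k - j)%:Z *: mesym n int j.

(** The shift is a natural number congruent to -(T + 1) mod [q], so that weight + shift + 1 is
    congruent to weight - T. Subtracting from 1 makes the good case the vanishing one. *)
Definition residue_mpoly (n T q : nat) : {mpoly int[n]} :=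
  1 - shifted_bin_mpoly n (q.-1 * T.+1) q.-1.

Lemma msize_mesym (n k : nat) (K : nzRingType) :
  (msize (mesym n K k) <= k.+1)%N.
Proof.
rewrite mesymE (leq_trans (mmeasure_sum _ _ _ _)) //.
by apply/bigmax_leqP_seq => h _ /eqP <-; rewrite msizeX mdeg_mesym1.
Qed.

Lemma msize_residue_mpoly (n T q : nat) :
  (0 < q)%N -> (msize (residue_mpoly n T q) <= q)%N.
Proof.
move=> q_gt0; rewrite (leq_trans (mmeasureD_le _ _ _)) // geq_max msize1 q_gt0.
rewrite mmeasureN (leq_trans (mmeasure_sum _ _ _ _)) //.
apply/bigmax_leqP => i _; rewrite (leq_trans (msizeZ_le _ _)) //.
rewrite (leq_trans (msize_mesym _ _ _)) //.
by case: i => i /=; rewrite prednK.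
Qed.

Section ZeroOnePoint.

Variables (n : nat) (a : 'I_n -> int).
Hypothesis a01 : forall i, a i = 0 \/ a i = 1.

Let supp := [set i | a i == 1].

Lemma zero_one_indicator (i : 'I_n) : a i = (i \in supp)%:R.
Proof. by rewrite inE; case: (a01 i) => ->. Qed.

Lemma sum_zero_one : \sum_(i < n) a i = #|supp|%:Z.
Proof.
under eq_bigr do rewrite zero_one_indicator.
by rewrite -natr_sum -big_mkcond sum1_card natz.
Qed.

(** The monomial of a [k]-subset [h] takes the value 1 if [h] lies in [supp] and 0 otherwise, so the
    sum counts the [k]-subsets of [supp]. *)
Lemma meval_mesym_zero_one (k : nat) :
  (mesym n int k).@[a] = 'C(#|supp|, k)%:Z.
Proof.
rewrite rmorph_sum -cards_draws /=.
rewrite -natz -sum1dep_card natr_sum big_mkcond [RHS]big_mkcond /=.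
apply: eq_bigr => h _; case: eqP => _; rewrite ?andbF // andbT.
rewrite rmorph_prod /=; under eq_bigr do rewrite mevalXU zero_one_indicator.
case: ifPn => [/subsetP h_supp | /subsetPn[i hi /negbTE iNsupp]].
  by rewrite big1 // => i /h_supp ->.
by rewrite (bigD1 i) //= iNsupp mul0r.
Qed.

Lemma meval_shifted_bin_mpoly (c k : nat) :
  (shifted_bin_mpoly n c k).@[a] = 'C(#|supp| + c, k)%:Z.
Proof.
rewrite -binomial.Vandermonde -natz natr_sum rmorph_sum.
apply: eq_bigr => j _.
by rewrite /= mevalZ meval_mesym_zero_one mulrC natz PoszM.
Qed.

Lemma dvdz_meval_residue_mpoly (T p k : nat) : prime p ->
  (p %| (residue_mpoly n T (p ^ k)).@[a])%Z = (#|supp| == T %[mod p ^ k])%N.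
Proof.
move=> pr_p; rewrite mevalB meval1 meval_shifted_bin_mpoly.
rewrite -[1]/(1%N%:Z) -eqz_mod_dvd !modz_nat eqz_nat modn_bin_pred_expn //.
set q := (p ^ k)%N; set m := (_ + _)%N.
have q_gt0 : (0 < q)%N by rewrite expn_gt0 prime_gt0.
have -> : (#|supp| == T %[mod q])%N = (q %| m.+1)%N.
  have -> : (q %| m.+1)%N = (m.+1 + T == 0 + T %[mod q])%N.
    by rewrite eqn_modDr mod0n.
  have -> : (m.+1 + T = T.+1 * q + #|supp|)%N.
    by rewrite /m -(prednK q_gt0) /=; ring.
  by rewrite modnMDl.
by case: (q %| _)%N; rewrite ?eqxx // mod0n modn_small ?prime_gt1.
Qed.

End ZeroOnePoint.

Lemma expn_near_sqrt (p n : nat) : prime p ->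
  exists k : nat, (n < (p ^ k) ^ 2)%N /\ ((p ^ k).-1 ^ 2 <= p ^ 2 * n)%N.
Proof.
move=> pr_p; have [-> | n_gt0] := posnP n.
  (* Here the power is 1, and the upper bound holds only thanks to the predecessor. *)
  by exists 0%N; rewrite muln0.
have p2_gt1 : (1 < p ^ 2)%N by rewrite (ltn_exp2l 0) ?prime_gt1.
have /andP[le_n lt_n] := trunc_log_bounds p2_gt1 n_gt0.
(* The previous power of [p ^ 2] is at most [n], so this one is at most [p ^ 2 * n]. *)
exists (trunc_log (p ^ 2) n).+1; rewrite expnAC; split=> //.
rewrite (@leq_trans ((p ^ (trunc_log (p ^ 2) n).+1) ^ 2)) //.
  by rewrite leq_exp2r // leq_pred.
by rewrite expnAC expnS leq_mul2l le_n orbT.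
Qed.

Theorem theorem3p2 (R : rcfType) (n T : nat) (hT : (T <= n)%N) :
  exists P : {mpoly int[n]},
    (total_degree P)%:R <= 3 * Num.sqrt (n%:R : R) /\
    forall a : 'I_n -> int, (forall i, a i = 0 \/ a i = 1) ->
      ((P.@[a] = 0 %[mod 6])%Z <-> \sum_(i < n) a i = T%:Z).
Proof.
have [k2 [lt_q2 le_q2]] := @expn_near_sqrt 2 n isT.
have [k3 [lt_q3 le_q3]] := @expn_near_sqrt 3 n isT.
set P2 := residue_mpoly n T (2 ^ k2); set P3 := residue_mpoly n T (3 ^ k3).
(* Mod 2 this is [P2]; mod 3 it is [P3] times the unit 2. *)
exists (3 *: P2 + 2 *: P3); split.
  set d := total_degree _.
  have d_le : (d <= maxn (2 ^ k2).-1 (3 ^ k3).-1)%N.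
    have q2_gt0 : (0 < 2 ^ k2)%N by rewrite expn_gt0.
    have q3_gt0 : (0 < 3 ^ k3)%N by rewrite expn_gt0.
    suff : (msize (3 *: P2 + 2 *: P3) <= maxn (2 ^ k2) (3 ^ k3))%N.
      by rewrite /d /total_degree; lia.
    rewrite (leq_trans (mmeasureD_le _ _ _)) // geq_max !leq_max.
    apply/andP; split; apply/orP; [left | right];
      by rewrite (leq_trans (msizeZ_le _ _)) // msize_residue_mpoly.
  have d2_le : (d ^ 2 <= 3 ^ 2 * n)%N.
    have le_q2' := leq_trans le_q2 (leq_mul (isT : 2 ^ 2 <= 3 ^ 2)%N (leqnn n)).
    move: d_le; rewrite leq_max -![(d <= _)%N](leq_exp2r _ _ (isT : 0 < 2)%N).
    by case/orP => /leq_trans; apply.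
  rewrite -(ler_pXn2r (isT : 0 < 2)%N) ?nnegrE ?mulr_ge0 ?sqrtr_ge0 //.
  by rewrite exprMn sqr_sqrtr // -!natrX -natrM ler_nat.
move=> a a01; rewrite sum_zero_one //; set w := #|_|.
have w_le : (w <= n)%N by rewrite (leq_trans (max_card _)) ?card_ord.
have P2E := dvdz_meval_residue_mpoly a01 T k2 (isT : prime 2).
have P3E := dvdz_meval_residue_mpoly a01 T k3 (isT : prime 3).
have co_q : coprime (2 ^ k2) (3 ^ k3) by rewrite coprimeXl ?coprimeXr.
(* Multiplying the two lower bounds gives [n ^ 2] below the square of the product. As [w] and [T]
   are at most [n], congruence modulo the product will mean equality. *)
have n_lt : (n < 2 ^ k2 * 3 ^ k3)%N.
  by rewrite -(ltn_exp2r _ _ (isT : 0 < 2)%N) expnMn -mulnn ltn_mul.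
rewrite mod0z; set x := meval a _.
have -> : (x %% 6)%Z = 0 <-> (6 %| x)%Z by split=> /dvdz_mod0P.
have -> : (6 %| x)%Z = (w == T)%N.
  rewrite -[6]/(2%:Z * 3%:Z) Gauss_dvdz // /x mevalD !mevalZ.
  rewrite (rpredDr _ (dvdz_mulr _ (dvdzz 2))).
  rewrite (rpredDl _ (dvdz_mulr _ (dvdzz 3))).
  rewrite !Gauss_dvdzr // P2E P3E -chinese_remainder //.
  by rewrite !modn_small // (leq_ltn_trans _ n_lt).
by split=> [/eqP-> | [->]].
Qed.
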